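(* Let $\mathcal{F}$ be a field of subsets of a set $\Omega$ and let $\mu$ and $\nu$ be charges on $\mathcal{F}$. Then $\mu$ splits into $\nu$-absolute continuous and $\nu$-singular parts; that is, there exist charges $\mu_{reg}$ and $\mu_{sing}$ on $\mathcal{F}$ such that $\mu=\mu_{reg}+\mu_{sing}$, where $\mu_{reg}$ is $\nu$-absolute continuous and $\mu_{sing}$ is $\nu$-singular.
   Context: A field of subsets of $\Omega$ is a family of subsets of $\Omega$ containing $\Omega$ and closed under complements and finite unions. A set function $\mu:\mathcal{F}\to\mathbb{R}$ is called a charge if $0\le\mu(A)\le\mu(\Omega)<+\infty$ for all $A\in\mathcal{F}$ and $\mu$ is (finitely) additive, i.e. $\mu(A\cup B)=\mu(A)+\mu(B)$ whenever $A,B\in\mathcal{F}$ are disjoint. For charges, $\mu\le\nu$ means $\mu(A)\le\nu(A)$ for all $A\in\mathcal{F}$. The charge $\mu$ is $\nu$-absolute continuous if for every $\varepsilon>0$ there exists $\delta>0$ such that $\mu(A)<\varepsilon$ whenever $A\in\mathcal{F}$ and $\nu(A)<\delta$. The charge $\mu$ is $\nu$-singular if for every charge $\eta$ on $\mathcal{F}$, the inequalities $\eta\le\mu$ and $\eta\le\nu$ imply that $\eta$ is the zero charge. *)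

(* Defs.v *)
From mathcomp Require Import all_boot all_order all_algebra.
From mathcomp Require Import all_classical reals measurable_structure.

Set Implicit Arguments.
Unset Strict Implicit.
Unset Printing Implicit Defensive.

Import Order.TTheory GRing.Theory Num.Theory.

Local Open Scope classical_set_scope.
Local Open Scope ring_scope.

(* Fields of sets are explicit families rather than [algebraOfSetsType]
   instances, since the latter would force the base set to be nonempty. *)
Definition set_field (T : Type) (F : set (set T)) : Prop :=
  [/\ F setT, setC_closed F & setU_closed F].

(* Set functions are total on [set T]; only their values on [F] matter. *)
Section Charges.
Context (R : realType) (T : Type) (F : set (set T)).
Implicit Types mu nu eta : set T -> R.

Definition is_charge mu : Prop :=
  (forall A, F A -> 0 <= mu A <= mu setT) /\
  (forall A B, F A -> F B -> A `&` B = set0 -> mu (A `|` B) = mu A + mu B).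

Definition charge_le mu nu : Prop := forall A, F A -> mu A <= nu A.

Definition charge_abs_continuous mu nu : Prop :=
  forall e : R, 0 < e -> exists2 d : R, 0 < d &
    forall A, F A -> nu A < d -> mu A < e.

Definition charge_singular mu nu : Prop :=
  forall eta, is_charge eta -> charge_le eta mu -> charge_le eta nu ->
    forall A, F A -> eta A = 0.

End Charges.

(* Main.v *)
Require Import Defs.
From mathcomp Require Import all_boot all_order all_algebra.
From mathcomp Require Import all_classical reals measurable_structure.
From mathcomp Require Import lra.

(* The singular part is given explicitly: mu_sing A is the infimum over d > 0
   of the supremum of mu B over the B in F with B `<=` A and nu B < d.
   Splitting each B along A and A' shows that mu_sing is additive.  If d is such
   that the supremum for A = Omega exceeds mu_sing Omega by less than e, then
   nu B < d/2 forces mu B + mu_sing (~` B) < mu_sing Omega + e, that is,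
   (mu - mu_sing) B < e.  Finally there are B with nu B arbitrarily small and
   mu B close to mu_sing Omega, so that mu_sing (~` B) is small too; a charge
   below both nu and mu_sing is therefore small on B and on ~` B. *)

Set Implicit Arguments.
Unset Strict Implicit.
Unset Printing Implicit Defensive.

Import Order.TTheory GRing.Theory Num.Theory.

Local Open Scope classical_set_scope.
Local Open Scope ring_scope.

Section SetField.
Context (T : Type) (F : set (set T)) (F_field : set_field F).

Lemma set_fieldT : F setT.
Proof. by case: F_field. Qed.

Lemma set_fieldC A : F A -> F (~` A).
Proof. by case: F_field => _ FC _; exact: FC. Qed.

Lemma set_fieldU A B : F A -> F B -> F (A `|` B).
Proof. by case: F_field => _ _ FU; exact: FU. Qed.

Lemma set_field0 : F set0.
Proof. by rewrite -setCT; exact/set_fieldC/set_fieldT. Qed.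

Lemma set_fieldI A B : F A -> F B -> F (A `&` B).
Proof.
by move=> FA FB; rewrite -(setCK (_ `&` _)) setCI; apply/set_fieldC/set_fieldU;
  exact: set_fieldC.
Qed.

Lemma set_fieldD A B : F A -> F B -> F (A `\` B).
Proof. by move=> FA FB; rewrite setDE; apply/set_fieldI/set_fieldC. Qed.

End SetField.

Section ChargeTheory.
Context (R : realType) (T : Type) (F : set (set T)) (F_field : set_field F).
Implicit Types (mu nu : set T -> R) (A B : set T).

(** The upper bound by [mu setT] comes for free: by additivity the difference is the value on the
    complement, which is nonnegative. *)
Lemma is_charge_additive mu :
    (forall A, F A -> 0 <= mu A) ->
    (forall A B, F A -> F B -> A `&` B = set0 -> mu (A `|` B) = mu A + mu B) ->
  is_charge F mu.
Proof.
move=> mu_ge0 mu_add; split=> // A FA; rewrite mu_ge0//=.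
have FCA := set_fieldC F_field FA.
by rewrite -(setUv A) mu_add ?setICr// lerDl mu_ge0.
Qed.

Section OneCharge.
Context (mu : set T -> R) (mu_charge : is_charge F mu).

Lemma charge_ge0 A : F A -> 0 <= mu A.
Proof. by case: mu_charge => + _ FA => /(_ A FA) /andP[]. Qed.

Lemma charge_leT A : F A -> mu A <= mu setT.
Proof. by case: mu_charge => + _ FA => /(_ A FA) /andP[]. Qed.

Lemma chargeU A B : F A -> F B -> A `&` B = set0 ->
  mu (A `|` B) = mu A + mu B.
Proof. by case: mu_charge => _; exact. Qed.

Lemma charge0 : mu set0 = 0.
Proof.
have F0 := set_field0 F_field.
by have := chargeU F0 F0 (setI0 _); rewrite setU0; lra.
Qed.

Lemma charge_mono A B : F A -> F B -> A `<=` B -> mu A <= mu B.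
Proof.
move=> FA FB AB; have FBA := set_fieldD F_field FB FA.
by rewrite -(setDUK AB) chargeU ?setDIK// lerDl charge_ge0.
Qed.

Lemma chargeC A : F A -> mu setT = mu A + mu (~` A).
Proof.
by move=> FA; rewrite -chargeU ?setUv ?setICr//; exact: set_fieldC.
Qed.

End OneCharge.

Section SingularPart.
Context (mu nu : set T -> R).
Context (mu_charge : is_charge F mu) (nu_charge : is_charge F nu).

(** For [d > 0] the set contains [mu set0] and is bounded by [mu setT], so [sup] is a true supremum
    rather than its default value. *)
Definition small_sup (d : R) A : R :=
  sup [set mu B | B in [set B | [/\ F B, B `<=` A & nu B < d]]].

(** As [small_sup d A] is nondecreasing in [d > 0], this infimum is its limit as [d] tends to 0. *)
Definition singular_part A : R :=
  inf [set small_sup d A | d in [set d | 0 < d]].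

Lemma le_small_sup d A B : F B -> B `<=` A -> nu B < d ->
  mu B <= small_sup d A.
Proof.
move=> FB BA Bd; apply: ub_le_sup; last by exists B.
by exists (mu setT) => _ [C [FC _ _] <-]; exact: charge_leT.
Qed.

Lemma small_sup_le d A c : 0 < d ->
  (forall B, F B -> B `<=` A -> nu B < d -> mu B <= c) -> small_sup d A <= c.
Proof.
move=> d0 Bc; apply: ge_sup => [|_ [B [FB BA Bd] <-]]; last exact: Bc.
exists (mu set0), set0 => //; split=> //; first exact: set_field0.
by rewrite charge0.
Qed.

Lemma small_sup_adherent d A e : 0 < d -> 0 < e ->
  exists B, [/\ F B, B `<=` A, nu B < d & small_sup d A - e < mu B].
Proof.
move=> d0 e0; apply: contrapT => noB.
suff: small_sup d A <= small_sup d A - e by lra.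
apply: small_sup_le => // B FB BA Bd; rewrite leNgt; apply/negP => eB.
by apply: noB; exists B.
Qed.

Lemma small_sup_ge0 d A : 0 < d -> 0 <= small_sup d A.
Proof.
move=> d0; rewrite -(charge0 mu_charge).
by apply: le_small_sup => //; [exact: set_field0 | rewrite charge0].
Qed.

(** Independent thresholds on the right allow the two infima to be taken one after the other. *)
Lemma small_sup_subadditive d d1 d2 A B : 0 < d -> d <= d1 -> d <= d2 ->
    F A -> F B ->
  small_sup d (A `|` B) <= small_sup d1 A + small_sup d2 B.
Proof.
move=> d0 dd1 dd2 FA FB; apply: small_sup_le => // C FC CAB Cd.
have FCA := set_fieldI F_field FC FA; have FCDA := set_fieldD F_field FC FA.
have CDA : C `\` A `<=` B by move=> x [Cx nAx]; case: (CAB x Cx).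
rewrite -(setUIDK C A) chargeU//; last by rewrite setDE setIACA setICr setI0.
apply: lerD; apply: le_small_sup => //.
  by apply: le_lt_trans (lt_le_trans Cd dd1); apply: charge_mono.
by apply: le_lt_trans (lt_le_trans Cd dd2); apply: charge_mono => // x [].
Qed.

(** Subsets admissible for [A] and for [B] are disjoint, so in their union both the [mu]-values and
    the thresholds add up. *)
Lemma small_sup_superadditive d1 d2 A B : 0 < d1 -> 0 < d2 ->
    A `&` B = set0 ->
  small_sup d1 A + small_sup d2 B <= small_sup (d1 + d2) (A `|` B).
Proof.
move=> d10 d20 AB0; rewrite -lerBrDr; apply: small_sup_le => // A' FA' AA' A'd.
rewrite lerBrDr -lerBrDl; apply: small_sup_le => // B' FB' BB' B'd.
have AB'0 : A' `&` B' = set0 by apply: subsetI_eq0 AB0.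
rewrite lerBrDl -chargeU//; apply: le_small_sup.
- exact: set_fieldU.
- exact: setUSS.
- by rewrite chargeU// ltrD.
Qed.

Lemma singular_part_le d A : 0 < d -> singular_part A <= small_sup d A.
Proof.
move=> d0; apply: ge_inf; last by exists d.
by exists 0 => _ [d' d'0 <-]; exact: small_sup_ge0.
Qed.

Lemma le_singular_part A c : (forall d, 0 < d -> c <= small_sup d A) ->
  c <= singular_part A.
Proof.
move=> cA; apply: lb_le_inf => [|_ [d d0 <-]]; last exact: cA.
by exists (small_sup 1 A), 1 => //=.
Qed.

Lemma singular_part_adherent A e : 0 < e ->
  exists2 d, 0 < d & small_sup d A < singular_part A + e.
Proof.
move=> e0; apply: contrapT => nod.
suff: singular_part A + e <= singular_part A by lra.
apply: le_singular_part => d d0; rewrite leNgt; apply/negP => Ad.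
by apply: nod; exists d.
Qed.

Lemma singular_partU A B : F A -> F B -> A `&` B = set0 ->
  singular_part (A `|` B) = singular_part A + singular_part B.
Proof.
move=> FA FB AB0; apply/eqP; rewrite eq_le; apply/andP; split.
  rewrite -lerBlDr; apply: le_singular_part => d1 d10.
  rewrite lerBlDr -lerBlDl; apply: le_singular_part => d2 d20.
  rewrite lerBlDl; have d0 : 0 < Num.min d1 d2 by rewrite lt_min d10.
  apply: le_trans (singular_part_le _ d0) _.
  by apply: small_sup_subadditive; rewrite ?ge_min ?lexx ?orbT.
apply: le_singular_part => d d0; have d20 : 0 < d / 2 by lra.
rewrite [d]splitr; apply: le_trans (small_sup_superadditive d20 d20 AB0).
by apply: lerD; apply: singular_part_le.
Qed.

Lemma singular_part_charge : is_charge F singular_part.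
Proof.
apply: is_charge_additive singular_partU => A FA.
by apply: le_singular_part => d; exact: small_sup_ge0.
Qed.

(** This makes [regular_part] nonnegative; the threshold 1 is an arbitrary choice. *)
Lemma singular_part_le_charge : charge_le F singular_part mu.
Proof.
move=> A FA; apply: le_trans (singular_part_le A ltr01) _.
by apply: small_sup_le => // B FB BA _; exact: charge_mono.
Qed.

Definition regular_part A : R := mu A - singular_part A.

Lemma regular_part_charge : is_charge F regular_part.
Proof.
apply: is_charge_additive => [A FA|A B FA FB AB0].
  by rewrite subr_ge0 singular_part_le_charge.
by rewrite /regular_part chargeU// singular_partU// opprD addrACA.
Qed.

Lemma regular_part_abs_continuous : charge_abs_continuous F regular_part nu.
Proof.
move=> e e0; have [d d0 Td] := singular_part_adherent setT e0.
have d20 : 0 < d / 2 by lra.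
exists (d / 2) => // A FA Ad; rewrite /regular_part.
(* With S for [singular_part], the chain is [mu A + S (~] A) <= small_sup d setT < S setT + e = S A
   + S (~[A) + e]. *)
have muA : mu A <= small_sup (d / 2) A by exact: le_small_sup.
have := small_sup_superadditive d20 d20 (setICr A).
rewrite -splitr setUv.
have := singular_part_le (~` A) d20.
have := chargeC singular_part_charge FA.
lra.
Qed.

Lemma singular_part_singular : charge_singular F singular_part nu.
Proof.
move=> eta eta_charge eta_sing eta_nu.
suff etaT : eta setT <= 0.
  move=> A FA; apply/eqP; rewrite eq_le charge_ge0// andbT.
  by apply: le_trans etaT; exact: charge_leT.
apply/ler_addgt0Pl => e e0; rewrite addr0.
have e30 : 0 < e / 3 by lra.
have [d d0 acd] := regular_part_abs_continuous e30.
(* The minimum serves two bounds: [nu B < d] gives [regular_part B < e / 3], and [nu B < e / 3]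
   gives [eta B < e / 3]. *)
have de0 : 0 < Num.min d (e / 3) by rewrite lt_min d0.
have [B [FB _ Bde muB]] := small_sup_adherent setT de0 e30.
have [Bd Be] : nu B < d /\ nu B < e / 3 by apply/andP; rewrite -lt_min.
have FCB := set_fieldC F_field FB.
have := acd B FB Bd; rewrite /regular_part.
have := singular_part_le setT de0.
have := chargeC singular_part_charge FB.
have := chargeC eta_charge FB.
have := eta_sing _ FCB.
have := eta_nu _ FB.
lra.
Qed.

End SingularPart.

End ChargeTheory.

Theorem theorem4p2 (R : realType) (Omega : Type) (F : set (set Omega))
    (mu nu : set Omega -> R) (F_field : set_field F)
    (mu_charge : is_charge F mu) (nu_charge : is_charge F nu) :
  exists mu_reg mu_sing : set Omega -> R,
    [/\ is_charge F mu_reg,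
        is_charge F mu_sing,
        (forall A, F A -> mu A = mu_reg A + mu_sing A),
        charge_abs_continuous F mu_reg nu
      & charge_singular F mu_sing nu].
Proof.
exists (regular_part F mu nu), (singular_part F mu nu); split.
- exact: regular_part_charge.
- exact: singular_part_charge.
- by move=> A _; rewrite /regular_part subrK.
- exact: regular_part_abs_continuous.
- exact: singular_part_singular.
Qed.
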